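(* There exists an absolute constant $C>0$ such that for every integer $d\ge 2$, every natural number $n\in\{0,1,2,\ldots\}$ is the sum of at most $C\,d$ palindromes in base $d$ (repetitions allowed).
   Context: $\mathbb{N}=\{0,1,2,\ldots\}$. For an integer $d\ge 2$, every $n\in\mathbb{N}$ has a unique base-$d$ representation $n=\sum_{j=0}^{l-1} d^j\delta_j$ with $l\ge 1$, digits $\delta_j\in\{0,1,\ldots,d-1\}$, and leading digit $\delta_{l-1}\neq 0$ whenever $l\ge 2$. The number $n$ is a palindrome in base $d$ if, in this representation, $\delta_j=\delta_{l-1-j}$ for all $0\le j<l$. In particular $0$ is a palindrome. *)

(* Defs.v *)
From mathcomp Require Import all_boot.

Set Implicit Arguments.
Unset Strict Implicit.
Unset Printing Implicit Defensive.

(* Digits are listed from the least significant one; the representation of 0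
   is [:: 0], not the empty sequence. *)
Definition base_repr (d n : nat) (s : seq nat) : Prop :=
  [/\ 1 <= size s,
      forall j, j < size s -> nth 0 s j < d,
      2 <= size s -> nth 0 s (size s).-1 != 0
    & n = \sum_(j < size s) d ^ j * nth 0 s j].

(* For 2 <= d there is exactly one s with base_repr d n s, so the existential
   quantifier speaks of the base-d representation of n. *)
Definition palindrome (d n : nat) : Prop :=
  exists2 s : seq nat, base_repr d n s &
    forall j, j < size s -> nth 0 s j = nth 0 s (size s - 1 - j).

(* Main.v *)
(** Fix [F = d ^ (2k+2)] and consider multisets of palindromic digit strings of
    length [2k+3] and [2k+2]. Outer digits summing to [a] in the longer strings
    and to [b] in the shorter ones contribute [a (1 + F) + b (1 + F / d)]. If
    [F <= n <= 2 d F], the choice of [a] brings [n] into [[F, 2F]], and then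
    [b < d] is dictated by divisibility by [d]: what remains is [d n'] with [n']
    again in [[d ^ 2k, 2 d d ^ 2k]]. As [a <= 2 d <= 4 (d - 1)], peeling off
    outer digits this way writes [n] with four longer strings and one shorter
    one, up to leading zeros. Leading digits are made nonzero by reserving a 1
    for each string in advance, and an arbitrary [n] is brought into the required
    range by subtracting [O(d)] copies of [(d - 1) (1 + F)]. *)
Require Import Defs.
From mathcomp Require Import all_boot zify.

Set Implicit Arguments.
Unset Strict Implicit.
Unset Printing Implicit Defensive.

(** * Digit strings and their values *)

Definition digit_value (d : nat) (s : seq nat) : nat :=
  foldr (fun x v => x + d * v) 0 s.

Definition wrap (x : nat) (s : seq nat) : seq nat := x :: rcons s x.

(** Leading zeros are allowed, so such a string need not be a base-[d] representation. *)
Definition sym_digits (d m : nat) (s : seq nat) : bool :=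
  [&& size s == m, all (fun x => x < d) s & rev s == s].

Lemma mem_zip (S T : eqType) (s : seq S) (t : seq T) x y :
  (x, y) \in zip s t -> (x \in s) && (y \in t).
Proof.
elim: s t => [|x0 s IHs] [|y0 t] //=; rewrite !in_cons.
case/orP=> [/eqP[-> ->] | /IHs/andP[-> ->]]; first by rewrite !eqxx.
by rewrite !orbT.
Qed.

Lemma digit_value_sum d s :
  digit_value d s = \sum_(j < size s) d ^ j * nth 0 s j.
Proof.
elim: s => [|x s IHs] /=; first by rewrite big_ord0.
rewrite big_ord_recl /= expn0 mul1n IHs big_distrr /=; congr (_ + _).
by apply: eq_bigr => i _; rewrite expnS mulnA.
Qed.

Lemma digit_value_wrap d x s :
  digit_value d (wrap x s) = x * (1 + d ^ (size s).+1) + d * digit_value d s.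
Proof.
have -> : digit_value d (wrap x s) = x + d * digit_value d (rcons s x) by [].
have -> : digit_value d (rcons s x) = digit_value d s + d ^ size s * x.
  elim: s => [|y s IHs] /=; first by rewrite muln0 addn0 mul1n.
  by rewrite IHs expnS mulnDr !addnA !mulnA.
by rewrite expnS; lia.
Qed.

Lemma digit_value_nseq0 d m : digit_value d (nseq m 0) = 0.
Proof. by elim: m => //= m ->; rewrite muln0. Qed.

Lemma sym_digits_wrap d m x s :
  x < d -> sym_digits d m s -> sym_digits d m.+2 (wrap x s).
Proof.
move=> ltxd /and3P[/eqP sz_s lt_s /eqP rev_s]; apply/and3P; split.
- by rewrite /= size_rcons sz_s.
- by rewrite /= all_rcons ltxd lt_s.
- by rewrite /wrap rev_cons rev_rcons rev_s rcons_cons.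
Qed.

Lemma sym_digits_nseq0 d m : 0 < d -> sym_digits d m (nseq m 0).
Proof.
move=> d_gt0; apply/and3P; split; first by rewrite size_nseq.
  by rewrite all_nseq d_gt0 orbT.
by rewrite rev_nseq.
Qed.

(** * From symmetric strings to palindromes *)

(** By symmetry the leading digit equals the lowest one, so it suffices that the latter is nonzero.
    A single digit is exempt, since 0 is a palindrome. *)
Lemma sym_digits_palindrome d m s :
  sym_digits d m.+1 s -> (0 < m -> nth 0 s 0 != 0) ->
  palindrome d (digit_value d s).
Proof.
move=> /and3P[/eqP sz_s /all_nthP lt_s /eqP rev_s] s0.
have sym_s j : j < size s -> nth 0 s j = nth 0 s (size s - 1 - j).
  by move=> ltj; rewrite -{1}rev_s nth_rev // subnAC subn1 -subnS.
exists s => //; split; first by rewrite sz_s.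
- by move=> j ltj; apply: lt_s.
- move=> sz2; rewrite -subn1 -(subn0 (size s - 1)) -sym_s; last by lia.
  by apply: s0; lia.
- exact: digit_value_sum.
Qed.

Lemma palindrome_wrap d m x s :
  0 < x < d -> sym_digits d m s -> palindrome d (digit_value d (wrap x s)).
Proof.
case/andP=> x_gt0 ltxd sym_s.
apply: sym_digits_palindrome (sym_digits_wrap ltxd sym_s) _ => _ /=.
by rewrite -lt0n.
Qed.

Lemma palindrome_two_digits d m x :
  0 < x < d -> palindrome d (x * (1 + d ^ m.+1)).
Proof.
move=> x_bd; have sym0 : sym_digits d m (nseq m 0).
  by apply: sym_digits_nseq0; lia.
have -> : x * (1 + d ^ m.+1) = digit_value d (wrap x (nseq m 0)).
  by rewrite digit_value_wrap digit_value_nseq0 size_nseq muln0 addn0.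
exact: palindrome_wrap x_bd sym0.
Qed.

Lemma palindrome_digit d x : x < d -> palindrome d x.
Proof.
move=> ltxd.
have -> : x = digit_value d [:: x] by rewrite /= muln0 addn0.
by apply: (@sym_digits_palindrome d 0) => //; rewrite /sym_digits /= ltxd eqxx.
Qed.

(** * Choosing and removing outer digits *)

Lemma sum_wrap d m (xs : seq nat) (ss : seq (seq nat)) :
  size xs = size ss -> all (sym_digits d m) ss ->
  sumn [seq digit_value d (wrap p.1 p.2) | p <- zip xs ss] =
  sumn xs * (1 + d ^ m.+1) + d * sumn [seq digit_value d s | s <- ss].
Proof.
elim: xs ss => [|x xs IHxs] [|s ss] //=; first by rewrite muln0.
move=> [eq_sz] /andP[/and3P[/eqP sz_s _ _] sym_ss].
move: (digit_value_wrap d x s) (IHxs ss eq_sz sym_ss); rewrite sz_s /= => -> ->.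
by rewrite !mulnDl !mulnDr addnACA.
Qed.

(** Greedy choice: each digit takes as much of [a] as it can hold. *)
Lemma spread_digits d c a :
  0 < d -> a <= c * d.-1 ->
  exists xs : seq nat,
    [/\ size xs = c, all (fun x => x < d) xs & sumn xs = a].
Proof.
move=> d_gt0; elim: c a => [|c IHc] a; rewrite ?mulSn => le_a.
  by exists [::]; split=> //=; lia.
have [|xs [sz_xs lt_xs sum_xs]] := IHc (a - minn a d.-1).
  by move: le_a; set e := c * _; lia.
exists (minn a d.-1 :: xs); split=> /=; first by rewrite sz_xs.
  by rewrite lt_xs andbT; lia.
by rewrite sum_xs; lia.
Qed.

Lemma peel_outer_digits d k n :
  1 < d -> d ^ k.*2.+2 <= n <= 2 * d * d ^ k.*2.+2 ->
  exists a b n' : nat,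
    [/\ a <= 2 * d, b < d,
        n = a * (1 + d ^ k.*2.+2) + b * (1 + d ^ k.*2.+1) + d * n'
      & d ^ k.*2 <= n' <= 2 * d * d ^ k.*2].
Proof.
move=> d_gt1; rewrite !expnS; set E := d ^ k.*2.
have E_gt0 : 0 < E by rewrite expn_gt0; lia.
set F := d * (d * E) => /andP[len gen].
(* Dividing [n - F] instead of [n] keeps [r] at least [F], which leaves room to subtract the [b]
   term. *)
pose a := (n - F) %/ (1 + F); pose r := F + (n - F) %% (1 + F).
have def_n : n = a * (1 + F) + r.
  by rewrite /r addnCA -divn_eq subnKC.
have ltr : r <= 2 * F.
  have : (n - F) %% (1 + F) < 1 + F by rewrite ltn_mod.
  by rewrite /r; lia.
have ger : F <= r by rewrite leq_addr.
(* Since [1 + d ^ k.*2.+1] is 1 modulo [d], divisibility of the rest by [d] forces this [b]. *)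
pose b := r %% d; pose q := r %/ d.
have b_ltd : b < d by rewrite ltn_mod; lia.
have def_r : r = q * d + b by rewrite -divn_eq.
have geq : d * E <= q by rewrite leq_divRL; [move: ger; rewrite /F; lia | lia].
have leq2 : q <= 2 * (d * E).
  have := leq_trunc_div r d; rewrite -/q => leqr.
  have : q * d <= 2 * (d * E) * d by move: ltr; rewrite /F; lia.
  by rewrite leq_pmul2r //; lia.
have leb : b * E <= d.-1 * E by rewrite leq_mul2r; lia.
have d1E : d * E = d.-1 * E + E by rewrite -mulSnr prednK //; lia.
(* From [r = q * d + b], removing [b * (1 + d * E)] leaves [d * (q - b * E)]; it stays large because
   [q >= d * E] and [b <= d.-1]. *)
exists a, b, (q - b * E); split=> //.
- rewrite -(@leq_pmul2r (1 + F)) //; apply: leq_trans (_ : n <= _).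
    by rewrite def_n leq_addr.
  by apply: leq_trans gen _; rewrite leq_mul2l leq_addl orbT.
- rewrite def_n def_r -!addnA; congr (_ + _).
  have : b * E <= q by lia.
  by move/subnKC; set z := q - b * E => <-; lia.
- by apply/andP; split; lia.
Qed.

Lemma sum_of_five_sym_digits d k n :
  1 < d -> d ^ k.*2 <= n <= 2 * d * d ^ k.*2 ->
  exists (ss : seq (seq nat)) (t : seq nat),
    [/\ size ss = 4, all (sym_digits d k.*2.+1) ss, sym_digits d k.*2 t
      & n = sumn [seq digit_value d s | s <- ss] + digit_value d t].
Proof.
move=> d_gt1; elim: k n => [|k IHk] n.
  rewrite muln1 => /andP[_ le_n].
  (* As [n <= 2 * d <= 4 * d.-1], four single digits suffice and the shorter string is empty. *)
  have [||xs [sz_xs lt_xs sum_xs]] := @spread_digits d 4 n; try by lia.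
  exists [seq [:: x] | x <- xs], [::]; split=> //; first by rewrite size_map.
    rewrite all_map; apply: sub_all lt_xs => x /= ltxd.
    by rewrite /sym_digits /= ltxd eqxx.
  rewrite -map_comp addn0 -sum_xs; congr sumn.
  by rewrite -[LHS]map_id; apply: eq_map => x /=; rewrite muln0 addn0.
rewrite doubleS => /(peel_outer_digits d_gt1)[a [b [n' [le_a lt_b def_n]]]].
case/IHk=> ss [t [sz_ss sym_ss sym_t def_n']].
have [||xs [sz_xs lt_xs sum_xs]] := @spread_digits d 4 a; try by lia.
exists [seq wrap p.1 p.2 | p <- zip xs ss], (wrap b t); split.
- by rewrite size_map size_zip sz_xs sz_ss.
- rewrite all_map; apply/allP => -[x s] /mem_zip /andP[x_xs s_ss] /=.
  by apply: sym_digits_wrap; [apply: (allP lt_xs) | apply: (allP sym_ss)].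
- exact: sym_digits_wrap.
have [/eqP sz_t _ _] := and3P sym_t.
rewrite -map_comp (sum_wrap _ sym_ss) ?sz_xs // digit_value_wrap sz_t sum_xs.
by rewrite def_n def_n'; lia.
Qed.

(** * Numbers in a window around a power of the base *)

Lemma sum_of_palindromes_mid d k n :
  1 < d -> 5 + d ^ k.*2.+1 + 5 * d ^ k.*2.+2 <= n ->
  n <= 5 + d ^ k.*2.+1 + 4 * d ^ k.*2.+2 + 2 * d * d ^ k.*2.+2 ->
  exists s : seq nat,
    [/\ size s <= 3 * d + 5, {in s, forall p, palindrome d p} & n = sumn s].
Proof.
move=> d_gt1 ge_n le_n.
set D := d ^ k.*2.+1 in ge_n le_n *; set F := d ^ k.*2.+2 in ge_n le_n *.
have range : F <= n - (4 * (1 + F) + (1 + D)) <= 2 * d * F.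
  by apply/andP; split; lia.
have [a [b [n' [le_a lt_b def_n]]]] := peel_outer_digits d_gt1 range.
case/(sum_of_five_sym_digits d_gt1)=> ss [t [sz_ss sym_ss sym_t def_n']].
have [/eqP sz_t _ _] := and3P sym_t.
(* Adding the outermost [a] and [b] to the reserved ones could overflow a digit, so they become
   [a + b < 3 * d] separate palindromes. *)
exists ([seq digit_value d (wrap p.1 p.2) | p <- zip (nseq 4 1) ss]
        ++ digit_value d (wrap 1 t) :: nseq a (1 + F) ++ nseq b (1 + D)).
have one_bd : 0 < 1 < d by [].
split.
- rewrite size_cat size_map size_zip sz_ss size_nseq minnn /=.
  by rewrite size_cat !size_nseq; lia.
- move=> p; rewrite mem_cat in_cons mem_cat !mem_nseq.
  case/or4P=> [/mapP[[x s] /mem_zip /andP[x1 s_ss] ->] | /eqP-> | |].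
  + move: x1; rewrite mem_nseq /= => /eqP->.
    exact: palindrome_wrap one_bd (allP sym_ss _ s_ss).
  + exact: palindrome_wrap one_bd sym_t.
  + by case/andP=> _ /eqP->; rewrite -[1 + F]mul1n; apply: palindrome_two_digits.
  + by case/andP=> _ /eqP->; rewrite -[1 + D]mul1n; apply: palindrome_two_digits.
rewrite sumn_cat (sum_wrap _ sym_ss) ?size_nseq ?sz_ss // digit_value_wrap sz_t.
rewrite /= sumn_cat !sumn_nseq -/D -/F; rewrite -/D -/F in def_n.
by move: def_n; rewrite def_n'; lia.
Qed.

(** * Reduction to the window and counting *)

Lemma quotient_bound d q : 1 < d -> q * d.-1 <= 7 * d ^ 2 -> q <= 14 * d.
Proof.
move=> d_gt1 le_q; rewrite -(@leq_pmul2r d.-1); last by lia.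
apply: leq_trans le_q _; rewrite (_ : 14 * d * d.-1 = 7 * d * (2 * d.-1)).
  by rewrite -mulnn mulnA leq_mul2l; lia.
by rewrite mulnCA !mulnA.
Qed.

Theorem theorem1 :
  exists C : nat, 0 < C /\
    forall d : nat, 2 <= d ->
    forall n : nat,
    exists s : seq nat,
      [/\ size s <= C * d,
          forall p : nat, p \in s -> palindrome d p
        & n = \sum_(p <- s) p].
Proof.
(* At most [14 * d] subtracted copies plus [3 * d + 5] others, and [5 <= 3 * d]. *)
exists 20; split=> // d d_gt1 n.
suff [s [sz_s pal_s sum_s]] : exists s : seq nat,
    [/\ size s <= 20 * d, {in s, forall p, palindrome d p} & n = sumn s].
  by exists s; split=> //; rewrite -sumnE.
have [n_small | n_large] := ltnP n (7 * d ^ 2).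
  exists (n %% d.-1 :: nseq (n %/ d.-1) d.-1); split.
  - rewrite /= size_nseq.
    suff : n %/ d.-1 <= 14 * d by lia.
    apply: quotient_bound => //.
    exact: leq_trans (leq_trunc_div n d.-1) (ltnW n_small).
  - move=> p; rewrite in_cons mem_nseq.
    case/orP=> [/eqP-> | /andP[_ /eqP->]]; apply: palindrome_digit; last by lia.
    have : n %% d.-1 < d.-1 by rewrite ltn_mod; lia.
    by lia.
  - by rewrite /= sumn_nseq addnC mulnC -divn_eq.
have [k /andP[ge_n lt_n]] :
    exists k, 7 * d ^ k.*2.+2 <= n < 7 * d ^ 2 * d ^ k.*2.+2.
  have d2_gt1 : 1 < d ^ 2 by rewrite -(exp1n 2) ltn_exp2r.
  have m_gt0 : 0 < n %/ 7 by rewrite divn_gt0 //; lia.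
  have /andP[] := trunc_log_bounds d2_gt1 m_gt0.
  (* Exponent 0 would give [n %/ 7 < d ^ 2], against [7 * d ^ 2 <= n]. *)
  case: (trunc_log _ _) => [_ | k]; first by rewrite expn1; lia.
  rewrite -!expnM mul2n doubleS => le_n; rewrite [2 * _]mulnC muln2 => lt_n.
  exists k; move: lt_n; rewrite !doubleS -mulnA -expnD add2n => lt_n.
  by apply/andP; split; lia.
set F := d ^ k.*2.+2 in ge_n lt_n.
have def_F : F = d * d ^ k.*2.+1 by rewrite -expnS.
set D := d ^ k.*2.+1 in def_F.
have D_ge2 : 2 <= D.
  by apply: leq_trans d_gt1 _; rewrite /D expnS leq_pmulr // expn_gt0; lia.
(* The window starts at [5 + D + 5 * F] and has length [(2 * d - 1) * F >= P], so reducing the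
   excess [m] modulo [P] lands in it. *)
pose P := d.-1 * (1 + F); pose m := n - (5 + D + 5 * F).
have le_m : 5 + D + 5 * F <= n.
  have : 2 * D <= F by rewrite def_F leq_mul2r d_gt1 orbT.
  by lia.
have P_gt0 : 0 < P by rewrite muln_gt0; lia.
have lt_mod : m %% P < P by rewrite ltn_mod.
have def_m : m = m %/ P * P + m %% P by apply: divn_eq.
have [||s [sz_s pal_s sum_s]] :=
  @sum_of_palindromes_mid d k (5 + D + 5 * F + m %% P) d_gt1.
- by rewrite -/D -/F leq_addr.
- rewrite -/D -/F; move: lt_mod; rewrite {2}/P mulnDr muln1.
  have : d.-1 <= d.-1 * F by rewrite leq_pmulr // expn_gt0; lia.
  have : 2 * d * F = 2 * (d.-1 * F) + 2 * F.
    by rewrite -{1}(@prednK d) ?mulnS; lia.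
  by set x := _ * F; set y := d.-1 * F; lia.
exists (nseq (m %/ P) P ++ s); split.
- rewrite size_cat size_nseq.
  have le_q : m %/ P * d.-1 * F <= 7 * d ^ 2 * F.
    apply: leq_trans (ltnW lt_n); apply: leq_trans (leq_subr (5 + D + 5 * F) n).
    apply: leq_trans (leq_trunc_div m P).
    by rewrite -mulnA !leq_mul2l leq_addl !orbT.
  rewrite leq_pmul2r ?expn_gt0 in le_q; last by lia.
  by have := quotient_bound d_gt1 le_q; lia.
- move=> p; rewrite mem_cat mem_nseq => /orP[/andP[_ /eqP->] | /pal_s //].
  by apply: palindrome_two_digits; lia.
- by rewrite sumn_cat sumn_nseq -sum_s; move: def_m; rewrite /m; lia.
Qed.
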